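(* Let $T\in\mathbb{R}_+^{N_1\times\cdots\times N_m}$ be an entrywise nonnegative tensor, and let $\boldsymbol{\sigma}=\{\sigma_i\}_{i=1}^d$ and $\tilde{\boldsymbol{\sigma}}=\{\tilde\sigma_i\}_{i=1}^{\tilde d}$ be shape partitions of $T$ such that $\boldsymbol{\sigma}\sqsubseteq\tilde{\boldsymbol{\sigma}}$. Then the following hold: (i) If $T$ is $\boldsymbol{\sigma}$-weakly irreducible, then $T$ is $\boldsymbol{\sigma}$-strictly nonnegative. (ii) If $T$ is $\boldsymbol{\sigma}$-strongly irreducible, then $T$ is $\boldsymbol{\sigma}$-weakly irreducible. (iii) If $T$ is $\boldsymbol{\sigma}$-strictly nonnegative, then $T$ is $\tilde{\boldsymbol{\sigma}}$-strictly nonnegative. (iv) If $T$ is $\boldsymbol{\sigma}$-weakly irreducible and $\tilde{\boldsymbol{\sigma}}$-symmetric, then $T$ is $\tilde{\boldsymbol{\sigma}}$-weakly irreducible. (v) If $T$ is $\boldsymbol{\sigma}$-strongly irreducible and $\tilde{\boldsymbol{\sigma}}$-symmetric, then $T$ is $\tilde{\boldsymbol{\sigma}}$-strongly irreducible.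
   Context: Write $[N]=\{1,\ldots,N\}$ and $\mathbb{R}_+=[0,\infty)$. For a tensor $T\in\mathbb{R}^{N_1\times\cdots\times N_m}$ let $f_T(z_1,\ldots,z_m)=\sum_{j_1\in[N_1],\ldots,j_m\in[N_m]}T_{j_1,\ldots,j_m}z_{1,j_1}\cdots z_{m,j_m}$ for $z_i\in\mathbb{R}^{N_i}$, and let $\mathcal{T}_{i,j_i}(z_1,\ldots,z_m)=\partial f_T/\partial z_{i,j_i}$, $\mathcal{T}_i=(\mathcal{T}_{i,1},\ldots,\mathcal{T}_{i,N_i})$. Shape partition: $\boldsymbol{\sigma}=\{\sigma_i\}_{i=1}^d$ is a shape partition of $T$ if it is a partition of $[m]$ (that is, $\bigcup_{i=1}^d\sigma_i=[m]$ and $\sigma_i\cap\sigma_j=\emptyset$ for $i\neq j$) such that $N_j=N_{j'}$ for every $i\in[d]$ and $j,j'\in\sigma_i$, and moreover (a) for every $i\in[d-1]$, $j\in\sigma_i$, $k\in\sigma_{i+1}$ one has $j\le k$; (b) if $d>1$, then $|\sigma_i|\le|\sigma_{i+1}|$ for every $i\in[d-1]$. Put $\nu_i=|\sigma_i|$, $s_i=\min\sigma_i$, $n_i=N_{s_i}$. For $x=(x_1,\ldots,x_d)\in\mathbb{R}^{n_1}\times\cdots\times\mathbb{R}^{n_d}$ let $x^{[\boldsymbol{\sigma}]}=(x_1,\ldots,x_1,x_2,\ldots,x_2,\ldots,x_d,\ldots,x_d)$ with $x_i$ repeated $\nu_i$ times. Let $\mathcal{I}^{\boldsymbol{\sigma}}=\bigcup_{i=1}^d\{i\}\times[n_i]$.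 Partial order: $\boldsymbol{\sigma}\sqsubseteq\tilde{\boldsymbol{\sigma}}$ means $d\ge\tilde d$ and there is $g:[d]\to[\tilde d]$ with $\sigma_i\subset\tilde\sigma_{g(i)}$ for all $i\in[d]$. Symmetry: $T$ is $\boldsymbol{\sigma}$-symmetric if for every $i\in[d]$ the value $T_{j_1,\ldots,j_m}$ does not change when any two indices $j_a,j_b$ with $a,b\in\sigma_i$ are interchanged (no condition when $|\sigma_i|=1$). Irreducibility classes: for nonnegative $T$ let $M$ be the square matrix indexed by $\mathcal{I}^{\boldsymbol{\sigma}}$ with entries $M_{(i,t_i),(k,l_k)}=\frac{\partial}{\partial x_{k,l_k}}\mathcal{T}_{s_i,t_i}(x^{[\boldsymbol{\sigma}]})\big|_{x=\mathbf{1}}$, where $\mathbf{1}$ is the vector of all ones. $T$ is - $\boldsymbol{\sigma}$-strictly nonnegative if $M$ has at least one nonzero entry per row; - $\boldsymbol{\sigma}$-weakly irreducible if $M$ is irreducible; - $\boldsymbol{\sigma}$-strongly irreducible if for every $x\in\mathbb{R}_+^{n_1}\times\cdots\times\mathbb{R}_+^{n_d}$ that is not entrywise positive and satisfies $x_i\neq0$ for all $i\in[d]$, there exists $(k,l_k)\in\mathcal{I}^{\boldsymbol{\sigma}}$ with $x_{k,l_k}=0$ and $\mathcal{T}_{s_k,l_k}(x^{[\boldsymbol{\sigma}]})>0$. The same definitions apply to $\tilde{\boldsymbol{\sigma}}$.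
   Formalization: Item (ii) is proved for m ≥ 2 and with either some N_j ≥ 2 or T nonzero; it fails otherwise (a positive vector with m = 1, N_1 ≥ 2 has M = 0; the zero tensor of format 1×...×1 is vacuously strongly irreducible). *)

(* Defs.v *)
From mathcomp Require Import all_boot all_order all_algebra.
From mathcomp Require Import reals normedtype derive.

Set Implicit Arguments.
Unset Strict Implicit.
Unset Printing Implicit Defensive.

Import Order.TTheory GRing.Theory Num.Theory.
Import numFieldNormedType.Exports.

Local Open Scope ring_scope.

(* All index sets are 0-based: [N] is 'I_N. *)

Definition bvec (R : realType) (p : nat) (n : 'I_p -> nat) : Type :=
  forall i : 'I_p, 'rV[R]_(n i).

(* The disjoint union of the {i} x [n_i]. *)
Notation bidx n := {i : 'I__ & 'I_(n i)}.

Definition mkbidx (p : nat) (n : 'I_p -> nat) (i : 'I_p) (t : 'I_(n i)) :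
  bidx n := Tagged (fun i => 'I_(n i)) t.

Definition coord (R : realType) (p : nat) (n : 'I_p -> nat)
  (z : bvec R n) (a : bidx n) : R := z (tag a) 0 (tagged a).

Definition set_coord (R : realType) (p : nat) (n : 'I_p -> nat)
  (z : bvec R n) (a : bidx n) (h : R) : bvec R n :=
  fun i => \row_t (if mkbidx t == a then h else z i 0 t).

Definition partial (R : realType) (p : nat) (n : 'I_p -> nat)
  (F : bvec R n -> R) (a : bidx n) (z : bvec R n) : R :=
  derive1 (fun h : R => F (set_coord z a h)) (coord z a).

Definition ones (R : realType) (p : nat) (n : 'I_p -> nat) : bvec R n :=
  fun i => const_mx 1.

Definition tidx (m : nat) (N : 'I_m -> nat) := {dffun forall j : 'I_m, 'I_(N j)}.

Definition tensor (R : realType) (m : nat) (N : 'I_m -> nat) :=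
  {ffun tidx N -> R}.

Definition tform (R : realType) (m : nat) (N : 'I_m -> nat)
  (T : tensor R N) (z : bvec R N) : R :=
  \sum_(J : tidx N) T J * \prod_(j < m) z j 0 (J j).

Definition tgrad (R : realType) (m : nat) (N : 'I_m -> nat)
  (T : tensor R N) (a : bidx N) : bvec R N -> R :=
  partial (tform T) a.

Record shape_partition (m : nat) (N : 'I_m -> nat) := ShapePartition {
  sp_size : nat;
  sp_block :> 'I_sp_size -> {set 'I_m};
  sp_neq0 : forall i, sp_block i != set0;
  sp_cover : \bigcup_(i < sp_size) sp_block i = [set: 'I_m];
  sp_disj : forall i i', i != i' -> sp_block i :&: sp_block i' = set0;
  sp_dim : forall i j j', j \in sp_block i -> j' \in sp_block i -> N j = N j';
  sp_mono : forall i i' : 'I_sp_size, i' = i.+1 :> nat ->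
    forall j k, j \in sp_block i -> k \in sp_block i' -> (j <= k)%N;
  sp_card : forall i i' : 'I_sp_size, i' = i.+1 :> nat ->
    (#|sp_block i| <= #|sp_block i'|)%N
}.

Section ShapePartition.
Variables (m : nat) (N : 'I_m -> nat) (s : shape_partition N).

Definition sp_min (i : 'I_(sp_size s)) : 'I_m :=
  [arg min_(j < xchoose (set0Pn _ (sp_neq0 i)) in s i) (j : nat)]%N.

Lemma sp_minP (i : 'I_(sp_size s)) :
  sp_min i \in s i /\ forall j, j \in s i -> (sp_min i <= j)%N.
Proof.
rewrite /sp_min; case: arg_minnP => [|j jsi jmin]; last by split.
exact: (xchooseP (set0Pn _ (sp_neq0 i))).
Qed.

Definition sp_dims (i : 'I_(sp_size s)) : nat := N (sp_min i).

Lemma sp_of_subproof (j : 'I_m) : exists i, j \in s i.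
Proof.
have : j \in \bigcup_(i < sp_size s) s i by rewrite sp_cover inE.
by case/bigcupP => i _ ji; exists i.
Qed.

Definition sp_of (j : 'I_m) : 'I_(sp_size s) := xchoose (sp_of_subproof j).

Lemma sp_ofP (j : 'I_m) : j \in s (sp_of j).
Proof. exact: (xchooseP (sp_of_subproof j)). Qed.

Lemma sp_dims_of (j : 'I_m) : N j = sp_dims (sp_of j).
Proof. exact: (sp_dim (sp_ofP j) (sp_minP _).1). Qed.

(* x^{[s]}: by sp_mono the blocks are consecutive intervals, so the j-th
   component of (x_1, .., x_1, x_2, .., x_d) is x_i for the i with j \in s i;
   the cast is along N j = N (min (s i)). *)
Definition sp_expand (R : realType) (x : bvec R sp_dims) : bvec R N :=
  fun j => \row_t x (sp_of j) 0 (cast_ord (sp_dims_of j) t).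

End ShapePartition.

Arguments sp_min {m N} s i.
Arguments sp_dims {m N} s i.
Arguments sp_of {m N} s j.
Arguments sp_expand {m N} s {R} x.

Definition sp_le (m : nat) (N : 'I_m -> nat) (s s' : shape_partition N) : Prop :=
  (sp_size s' <= sp_size s)%N /\
  exists g : 'I_(sp_size s) -> 'I_(sp_size s'),
    forall i, s i \subset s' (g i).

(* Interchange of two indices is stated on nat values since 'I_(N a) and
   'I_(N b) are only propositionally equal types. *)
Definition sp_symmetric (R : realType) (m : nat) (N : 'I_m -> nat)
  (T : tensor R N) (s : shape_partition N) : Prop :=
  forall (i : 'I_(sp_size s)) (a b : 'I_m), a \in s i -> b \in s i ->
  forall J J' : tidx N,
    J' a = J b :> nat -> J' b = J a :> nat ->
    (forall c, c != a -> c != b -> J' c = J c) ->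
    T J' = T J.

(* The matrix M attached to (T, s): the row (i, t) is the gradient at 1 of
   x |-> tgrad T (s_i, t)(x^{[s]}), where s_i = min (s i). *)
Definition sp_jacobian (R : realType) (m : nat) (N : 'I_m -> nat)
  (T : tensor R N) (s : shape_partition N) (a b : bidx (sp_dims s)) : R :=
  partial (fun x : bvec R (sp_dims s) =>
      tgrad T (@mkbidx m N (sp_min s (tag a)) (tagged a)) (sp_expand s x))
    b (ones R (sp_dims s)).

(* M cannot be put in block triangular form with two nonempty diagonal blocks
   by a simultaneous permutation of rows and columns; as usual the 1 x 1 zero
   matrix is reducible. *)
Definition irreducible_matrix (R : realType) (I : finType) (M : I -> I -> R) :
  Prop :=
  (#|I| = 1%N -> exists a, M a a != 0) /\
  (forall J : {set I}, J != set0 -> J != [set: I] ->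
     exists a b, [/\ a \in J, b \notin J & M a b != 0]).

Definition strictly_nonnegative (R : realType) (m : nat) (N : 'I_m -> nat)
  (T : tensor R N) (s : shape_partition N) : Prop :=
  forall a, exists b, sp_jacobian T (s := s) a b != 0.

Definition weakly_irreducible (R : realType) (m : nat) (N : 'I_m -> nat)
  (T : tensor R N) (s : shape_partition N) : Prop :=
  irreducible_matrix (sp_jacobian T (s := s)).

Definition strongly_irreducible (R : realType) (m : nat) (N : 'I_m -> nat)
  (T : tensor R N) (s : shape_partition N) : Prop :=
  forall x : bvec R (sp_dims s),
    (forall a, 0 <= coord x a) ->
    ~ (forall a, 0 < coord x a) ->
    (forall i, x i != 0) ->
    exists a : bidx (sp_dims s), coord x a = 0 /\
      0 < tgrad T (@mkbidx m N (sp_min s (tag a)) (tagged a)) (sp_expand s x).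

(* Main.v *)
Require Import Defs.
From mathcomp Require Import all_boot all_order all_algebra.
From mathcomp Require Import perm boolp reals normedtype derive.
(* The vector library also exports a constant named coord. *)
Import Defs.

Set Implicit Arguments.
Unset Strict Implicit.
Unset Printing Implicit Defensive.

Import Order.TTheory GRing.Theory Num.Theory.
Import numFieldNormedType.Exports.

Local Open Scope ring_scope.

(** Everything here depends on [T] only through its support, the set of
    multi-indices [J] with [T J != 0].  Call [node s J j] the pair (block of
    [j], value of [J j]) that the [j]-th entry of [J] contributes to the index
    set of [s].  Since [T] is nonnegative, no cancellation occurs in the sums
    that compute derivatives, so:
    - [M a b != 0] iff some [J] in the support has node [a] at the smallest
      position of the block of [a], and node [b] at another position
      ([sp_jacobian_neq0P]);
    - the gradient at [(a, x)] is positive iff some [J] in the support has node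
      [a] at that smallest position, and [x] positive at the nodes of all other
      positions ([tgrad_expand_gt0P]).

    Read as a graph on the nodes, (i) says that in an irreducible graph every
    vertex has an out-edge.

    For (ii), let [Z] be a nonempty proper set of nodes without an edge leaving
    it.  If [Z] contains no full block, strong irreducibility applied to the
    indicator of the complement of [Z] gives a [J] whose entries at all
    positions but one, which is in [Z], lie outside [Z]; as the order is at
    least two, this is an edge leaving [Z].  If [Z] contains a full block, then
    the node of every [J] at the first position of that block is in [Z], hence
    all nodes of every [J] in the support are.  Then a node [b] outside [Z] is
    met by no [J] in the support.  When the block of [b] has at least two
    elements, the vector that vanishes at [b] only contradicts this
    ([strongly_irreducible_cover]); when [b] is alone in its block, every [J]
    meets [b].

    For (iii)-(v), [coarsen] sends nodes of [s] onto nodes of [s'], and the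
    smallest position of a block of [s'] is also the smallest position of the
    block of [s] that contains it; hence the rows of [M] for [s'] are obtained
    from some of those for [s] by merging columns, which is (iii).  The
    remaining rows are handled by symmetry: swapping the smallest position of a
    block of [s] with that of the block of [s'] around it keeps [J] in the
    support ([symmetric_coarsen]).  So edges of [s] map to edges of [s'], which
    gives (iv), and a vector for [s'] can be pulled back along [coarsen] to one
    for [s], which gives (v). *)

(** * Partial derivatives and supports *)

(** Both the gradient of the form and the Jacobian at the all-ones vector
    differentiate a function that is polynomial in the moving coordinate. *)
Lemma partial_sum_pow (R : realType) (p : nat) (n : 'I_p -> nat)
    (F : bvec R n -> R) (a : bidx n) (z : bvec R n)
    (I : finType) (P : pred I) (c : I -> R) (k : I -> nat) :
  (forall h, F (set_coord z a h) = \sum_(i | P i) c i * h ^+ k i) ->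
  partial F a z = \sum_(i | P i) c i * (coord z a ^+ (k i).-1 *+ k i).
Proof.
move=> Fh; pose q : {poly R} := \sum_(i | P i) c i *: 'X^(k i).
have -> : partial F a z = derive1 (horner q) (coord z a).
  congr (derive1 _ _); apply: funext => h; rewrite Fh horner_sum.
  by apply: eq_bigr => i _; rewrite hornerZ hornerXn.
rewrite -derivE raddf_sum horner_sum /=; apply: eq_bigr => i _.
by rewrite derivZ derivXn hornerZ hornerMn hornerXn.
Qed.

(** Comparing values in [nat] makes the casts between the types [ 'I_(N j) ]
    of a block disappear. *)
Lemma bidx_eq (p : nat) (n : 'I_p -> nat) (a b : bidx n) :
  tag a = tag b -> tagged a = tagged b :> nat -> a = b.
Proof.
case: a b => [i t] [j u] /= eij; move: u; case: _ / eij => u etu.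
by congr existT; apply: val_inj.
Qed.

Lemma set_coordE (R : realType) (p : nat) (n : 'I_p -> nat) (z : bvec R n)
    (a b : bidx n) (h : R) :
  coord (set_coord z a h) b = if b == a then h else coord z b.
Proof. by case: b => i t; rewrite /coord mxE. Qed.

Definition entry (m : nat) (N : 'I_m -> nat) (J : tidx N) (j : 'I_m) : bidx N :=
  mkbidx (J j).

Lemma tag_entry (m : nat) (N : 'I_m -> nat) (J : tidx N) (a : bidx N) j :
  entry J j = a -> j = tag a.
Proof. by move<-. Qed.

(** The form is multilinear, so the moving coordinate occurs in the term of [J]
    with exponent 1 or 0, according to whether [J] passes through [a]. *)
Lemma tgradE (R : realType) (m : nat) (N : 'I_m -> nat) (T : tensor R N)
    (a : bidx N) (z : bvec R N) :
  tgrad T a z = \sum_(J : tidx N | entry J (tag a) == a)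
    T J * \prod_(j < m | j != tag a) coord z (entry J j).
Proof.
pose k (J : tidx N) := entry J (tag a) == a.
pose c (J : tidx N) := T J * \prod_(j < m | j != tag a) coord z (entry J j) *
                       (if k J then 1 else coord z (entry J (tag a))).
rewrite /tgrad (@partial_sum_pow _ _ _ _ _ _ _ xpredT c
  (fun J => nat_of_bool (k J))) => [|h]; last first.
  rewrite /tform; apply: eq_bigr => J _.
  rewrite (bigD1 (tag a)) //= /c -!mulrA; congr (_ * _).
  rewrite mulrC; congr (_ * _).
    apply: eq_bigr => j ja.
    have := set_coordE z a (entry J j) h.
    by rewrite ifN //; apply: contra ja => /eqP/tag_entry->.
  have := set_coordE z a (entry J (tag a)) h.
  rewrite -[coord _ _]/(set_coord z a h _ 0 _) => ->.
  by rewrite /k; case: ifP => _ /=; rewrite ?mul1r ?mulr1.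
rewrite [RHS]big_mkcond; apply: eq_bigr => J _.
by rewrite /c /k; case: eqP => _; rewrite ?mulr0 // expr0 !mulr1.
Qed.

Definition proj (m : nat) (N : 'I_m -> nat) (s : shape_partition N) (c : bidx N)
    : bidx (sp_dims s) :=
  mkbidx (cast_ord (sp_dims_of s (tag c)) (tagged c)).

Definition node (m : nat) (N : 'I_m -> nat) (s : shape_partition N) (J : tidx N)
    (j : 'I_m) : bidx (sp_dims s) := proj s (entry J j).

(** The coordinate of [f_T] along which the row [a] of the matrix [M] is
    defined. *)
Definition rep (m : nat) (N : 'I_m -> nat) (s : shape_partition N)
    (a : bidx (sp_dims s)) : bidx N :=
  @mkbidx m N (sp_min s (tag a)) (tagged a).

Lemma sp_of_eq (m : nat) (N : 'I_m -> nat) (s : shape_partition N) i j :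
  j \in s i -> sp_of s j = i.
Proof.
move=> ji; apply/eqP/negPn/negP => /(@sp_disj _ _ s)/setP/(_ j).
by rewrite !inE ji sp_ofP.
Qed.

Lemma sp_of_min (m : nat) (N : 'I_m -> nat) (s : shape_partition N) i :
  sp_of s (sp_min s i) = i.
Proof. exact/sp_of_eq/(sp_minP i).1. Qed.

Lemma repK (m : nat) (N : 'I_m -> nat) (s : shape_partition N) :
  cancel (@rep _ _ s) (proj s).
Proof. by move=> a; apply: bidx_eq => //=; rewrite sp_of_min. Qed.

Lemma node_min (m : nat) (N : 'I_m -> nat) (s : shape_partition N) (J : tidx N)
    (a : bidx (sp_dims s)) :
  (entry J (sp_min s (tag a)) == rep a) = (node s J (sp_min s (tag a)) == a).
Proof.
apply/eqP/eqP => [e|]; first by rewrite /node e repK.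
case: a => i t /(congr1 (fun b : bidx _ => nat_of_ord (tagged b))) /= e.
exact: bidx_eq.
Qed.

Lemma coord_expand (R : realType) (m : nat) (N : 'I_m -> nat)
    (s : shape_partition N) (x : bvec R (sp_dims s)) (c : bidx N) :
  coord (sp_expand s x) c = coord x (proj s c).
Proof. by rewrite /coord mxE. Qed.

Lemma tgrad_expandE (R : realType) (m : nat) (N : 'I_m -> nat) (T : tensor R N)
    (s : shape_partition N) (a : bidx (sp_dims s)) (x : bvec R (sp_dims s)) :
  tgrad T (rep a) (sp_expand s x) =
  \sum_(J : tidx N | node s J (sp_min s (tag a)) == a)
    T J * \prod_(j < m | j != sp_min s (tag a)) coord x (node s J j).
Proof.
rewrite tgradE; apply: eq_big => [J|J _]; first by rewrite node_min.
by congr (_ * _); apply: eq_bigr => j _; rewrite coord_expand.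
Qed.

Lemma tgrad_expand_gt0P (R : realType) (m : nat) (N : 'I_m -> nat)
    (T : tensor R N) (s : shape_partition N) (a : bidx (sp_dims s))
    (x : bvec R (sp_dims s)) :
  (forall J, 0 <= T J) -> (forall b, 0 <= coord x b) ->
  0 < tgrad T (rep a) (sp_expand s x) <->
  exists J : tidx N, [/\ T J != 0, node s J (sp_min s (tag a)) = a &
    forall j, j != sp_min s (tag a) -> 0 < coord x (node s J j)].
Proof.
move=> T0 x0; rewrite tgrad_expandE; set F := BIG_F.
have F0 J : 0 <= F J by rewrite mulr_ge0 // prodr_ge0.
rewrite lt0r sumr_ge0 // andbT; split.
  move=> /eqP/(psumr_neq0P (fun J _ => F0 J))[J /andP[/eqP Ja]].
  rewrite lt0r => /andP[+ _]; rewrite mulf_eq0 negb_or => /andP[TJ /prodf_neq0 xJ].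
  by exists J; split=> // j jm; rewrite lt0r xJ /=.
case=> J [TJ /eqP Ja xJ]; rewrite psumr_neq0 //; apply/hasP.
exists J; first exact: mem_index_enum.
by rewrite Ja mulr_gt0 ?prodr_gt0 // lt0r TJ /=.
Qed.

(** After the specialization at ones, the term of [J] contributes [T J] times
    the number of positions, other than the smallest one of the block of [a],
    that carry [b]; nonnegativity makes the sum vanish only termwise. *)
Lemma sp_jacobian_neq0P (R : realType) (m : nat) (N : 'I_m -> nat)
    (T : tensor R N) (s : shape_partition N) (a b : bidx (sp_dims s)) :
  (forall J, 0 <= T J) ->
  sp_jacobian T a b != 0 <->
  exists (J : tidx N) (j : 'I_m), [/\ T J != 0,
    node s J (sp_min s (tag a)) = a, j != sp_min s (tag a) & node s J j = b].
Proof.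
move=> T0.
pose k (J : tidx N) := #|[pred j | j != sp_min s (tag a) & node s J j == b]|.
have -> : sp_jacobian T a b =
    \sum_(J : tidx N | node s J (sp_min s (tag a)) == a) T J * (k J)%:R.
  rewrite /sp_jacobian (partial_sum_pow (c := T) (k := k)
    (P := fun J => node s J (sp_min s (tag a)) == a)) => [|h].
    by apply: eq_bigr => J _; rewrite /coord mxE expr1n.
  rewrite tgrad_expandE; apply: eq_bigr => J _; congr (_ * _).
  rewrite -prodr_const big_mkcondr; apply: eq_bigr => j _.
  by rewrite set_coordE /coord mxE; case: eqP.
split.
  move=> /eqP/psumr_neq0P[J _|J /andP[/eqP Ja]]; first by rewrite mulr_ge0.
  rewrite lt0r mulf_eq0 negb_or pnatr_eq0 -lt0n => /andP[/andP[TJ /card_gt0P[j]]].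
  by rewrite inE => /andP[jm /eqP jb] _; exists J, j.
case=> J [j [TJ /eqP Ja jm /eqP jb]].
rewrite psumr_neq0; last by move=> ? _; rewrite mulr_ge0.
apply/hasP; exists J; first exact: mem_index_enum.
rewrite Ja lt0r mulf_eq0 negb_or TJ pnatr_eq0 -lt0n mulr_ge0 //= andbT.
by apply/card_gt0P; exists j; rewrite inE jm.
Qed.

(** * Weak and strong irreducibility *)

(** Irreducibility applied to the singleton of the row index; the case of a
    one-element index set is the separate clause of irreducibility. *)
Lemma weakly_irreducible_strictly_nonnegative (R : realType) (m : nat)
    (N : 'I_m -> nat) (T : tensor R N) (s : shape_partition N) :
  weakly_irreducible T s -> strictly_nonnegative T s.
Proof.
move=> [irr1 irr] a; have [aT|aT] := eqVneq [set a] [set: _].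
  have eq_a c : c = a by have := in_setT c; rewrite -aT inE => /eqP.
  case: irr1 => [|b nz]; first by rewrite -cardsT -aT cards1.
  by rewrite (eq_a b) in nz; exists a.
have [|b [c [+ _ nz]]] := irr [set a] _ aT.
  by apply/set0Pn; exists a; rewrite inE.
by rewrite inE => /eqP eb; exists c; rewrite -eb.
Qed.

(** Strong irreducibility is used at the indicator of the complement of [Z]: the
    hypothesis on blocks makes each component of this vector nonzero. *)
Lemma strongly_irreducible_entry (R : realType) (m : nat) (N : 'I_m -> nat)
    (T : tensor R N) (s : shape_partition N) (Z : {set bidx (sp_dims s)}) :
  (forall J, 0 <= T J) -> strongly_irreducible T s -> Z != set0 ->
  (forall i, exists t : 'I_(sp_dims s i), mkbidx t \notin Z) ->
  exists (J : tidx N) a, [/\ T J != 0, a \in Z,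
    node s J (sp_min s (tag a)) = a &
    forall j, j != sp_min s (tag a) -> node s J j \notin Z].
Proof.
move=> T0 irr /set0Pn[z Zz] Zfree.
pose x : bvec R (sp_dims s) := fun i => \row_t (mkbidx t \notin Z)%:R.
have xE a : coord x a = (a \notin Z)%:R by case: a => i t; rewrite /coord mxE.
have x0 a : 0 <= coord x a by rewrite xE ler0n.
have [|i|a [xa]] := irr x x0.
- by move=> /(_ z); rewrite xE Zz ltxx.
- have [t Zt] := Zfree i; apply/eqP => /matrixP/(_ 0 t).
  by rewrite !mxE Zt => /eqP; rewrite oner_eq0.
case/(tgrad_expand_gt0P a T0 x0) => J [TJ Ja xJ]; exists J, a; split=> //.
  by move: xa; rewrite xE; case: (a \in Z) => // /eqP; rewrite oner_eq0.
by move=> j /xJ; rewrite xE; case: (_ \notin Z); rewrite ?ltxx.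
Qed.

(** The case of a singleton [Z]. A block with a single node has to be excluded,
    because the vector vanishing there would have a zero component. *)
Lemma strongly_irreducible_cover (R : realType) (m : nat) (N : 'I_m -> nat)
    (T : tensor R N) (s : shape_partition N) (b : bidx (sp_dims s)) :
  (forall j, (0 < N j)%N) -> (forall J, 0 <= T J) -> strongly_irreducible T s ->
  (1 < sp_dims s (tag b))%N ->
  exists J : tidx N, T J != 0 /\ node s J (sp_min s (tag b)) = b.
Proof.
move=> N0 T0 irr nb.
have [||J [a [TJ]]] := @strongly_irreducible_entry _ _ _ _ _ [set b] T0 irr.
- by apply/set0Pn; exists b; rewrite inE.
- move=> i; have [ei|ni] := eqVneq i (tag b); last first.
    by exists (Ordinal (N0 (sp_min s i))); rewrite inE; apply: contra ni => /eqP<-.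
  have [t nt] : exists t : 'I_(sp_dims s i), t != tagged b :> nat.
    have n1 : (1 < sp_dims s i)%N by rewrite ei.
    have [b0|] := eqVneq (tagged b : nat) 0%N.
      by exists (Ordinal n1); rewrite b0.
    by exists (Ordinal (ltnW n1)); rewrite eq_sym.
  by exists t; rewrite inE; apply: contra nt => /eqP<-.
by rewrite inE => /eqP-> Jb _; exists J.
Qed.

Lemma strongly_irreducible_neq0 (R : realType) (m : nat) (N : 'I_m -> nat)
    (T : tensor R N) (s : shape_partition N) :
  (forall j, (0 < N j)%N) -> (forall J, 0 <= T J) -> strongly_irreducible T s ->
  (exists j : 'I_m, (1 < N j)%N) -> exists J : tidx N, T J != 0.
Proof.
move=> N0 T0 irr [j Nj].
have [|J [TJ _]] := @strongly_irreducible_cover _ _ _ _ s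
    (proj s (@mkbidx m N j (Ordinal (N0 j)))) N0 T0 irr; last by exists J.
by rewrite /= -sp_dims_of.
Qed.

Lemma ex_neq_ord (m : nat) (i : 'I_m) : (1 < m)%N -> exists j, j != i.
Proof.
move=> m1; have := cardC1 i; rewrite card_ord => c.
have /card_gt0P[j ji] : (0 < #|predC1 i|)%N; last by exists j.
by rewrite c -ltnS prednK // ltnW.
Qed.

Lemma strongly_irreducible_weakly_irreducible (R : realType) (m : nat)
    (N : 'I_m -> nat) (T : tensor R N) (s : shape_partition N) :
  (1 < m)%N -> (forall j, (0 < N j)%N) -> (forall J, 0 <= T J) ->
  (exists J : tidx N, T J != 0) ->
  strongly_irreducible T s -> weakly_irreducible T s.
Proof.
move=> m1 N0 T0 [I TI] irr; split=> [/eqP/fintype1P[a eq_a]|Z Z0 ZT].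
  have [j ja] := ex_neq_ord (sp_min s (tag a)) m1.
  by exists a; apply/(sp_jacobian_neq0P a a T0); exists I, j; split.
apply: contrapT => no_exit.
have closed J j a : T J != 0 -> node s J (sp_min s (tag a)) = a -> a \in Z ->
    j != sp_min s (tag a) -> node s J j \in Z.
  move=> TJ Ja Za ja; apply/negPn/negP => Zj; apply: no_exit.
  exists a, (node s J j); split=> //.
  by apply/(sp_jacobian_neq0P _ _ T0); exists J, j; split.
(* [Z] contains no full block, or contains the full block [k]. *)
have [Zfree|] := pselect (forall i, exists t : 'I_(sp_dims s i), mkbidx t \notin Z).
  have [J [a [TJ Za Ja JZ]]] := strongly_irreducible_entry T0 irr Z0 Zfree.
  have [j ja] := ex_neq_ord (sp_min s (tag a)) m1.
  by have := JZ j ja; rewrite (closed J j a).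
move=> /existsNP[k /forallNP Zk].
have inZ J j : T J != 0 -> node s J j \in Z.
  move=> TJ; pose a := node s J (sp_min s k).
  have ak : tag a = k by rewrite /a /= sp_of_min.
  have Za : a \in Z.
    case: (a) ak => i t /= ei; move: t; rewrite ei => t.
    by apply/negPn/negP => /Zk.
  have [->//|jk] := eqVneq j (sp_min s k).
  by apply: (closed J j a); rewrite ?ak.
have /subsetPn[b _ Zb] : ~~ ([set: _] \subset Z) by rewrite subTset.
(* [b] is met by the support; its block may consist of [b] alone, in which case
   every multi-index passes through [b]. *)
have [J [TJ Jb]] : exists J : tidx N, T J != 0 /\ node s J (sp_min s (tag b)) = b.
  have [nb|nb] := ltnP 1 (sp_dims s (tag b)).
    exact: strongly_irreducible_cover.
  exists I; split=> //; apply: bidx_eq; first by rewrite /= sp_of_min.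
  have lt0 n (t : 'I_n) : (n <= 1)%N -> t = 0%N :> nat.
    by move=> n1; have := leq_trans (ltn_ord t) n1; case: (t : nat).
  by rewrite !lt0 //= sp_of_min.
by move: Zb; rewrite -Jb inZ.
Qed.

(** * Passing to a coarser partition *)

Definition coarsen (m : nat) (N : 'I_m -> nat) (s s' : shape_partition N)
    (a : bidx (sp_dims s)) : bidx (sp_dims s') := proj s' (rep a).

Lemma sp_of_le (m : nat) (N : 'I_m -> nat) (s s' : shape_partition N) j k :
  sp_le s s' -> sp_of s j = sp_of s k -> sp_of s' j = sp_of s' k.
Proof.
move=> [_ [g sg]] e.
have in_g i : sp_of s i = sp_of s k -> sp_of s' i = g (sp_of s k).
  by move=> <-; apply: sp_of_eq; apply: (subsetP (sg _)); exact: sp_ofP.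
by rewrite !in_g.
Qed.

(** The smallest element of a set is the smallest of any subset containing
    it. *)
Lemma sp_min_le (m : nat) (N : 'I_m -> nat) (s s' : shape_partition N) i :
  sp_le s s' -> sp_min s (sp_of s (sp_min s' i)) = sp_min s' i.
Proof.
move=> le; apply/val_inj/eqP; rewrite eqn_leq (sp_minP _).2 ?sp_ofP //=.
apply: (sp_minP _).2; rewrite -{2}(sp_of_min i) -(sp_of_le le (sp_of_min _)).
exact: sp_ofP.
Qed.

Lemma coarsen_proj (m : nat) (N : 'I_m -> nat) (s s' : shape_partition N)
    (c : bidx N) :
  sp_le s s' -> coarsen s' (proj s c) = proj s' c.
Proof. by move=> le; apply: bidx_eq => //=; apply/(sp_of_le le)/sp_of_min. Qed.

Lemma coarsenK (m : nat) (N : 'I_m -> nat) (s s' : shape_partition N)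
    (a : bidx (sp_dims s')) :
  sp_le s s' -> coarsen s' (proj s (rep a)) = a.
Proof. by move=> le; rewrite coarsen_proj // repK. Qed.

(** The equality of nodes, and not only of [T], records that the swap permutes
    the contributions of [J] to the index set of [s]. *)
Lemma swap_entries (R : realType) (m : nat) (N : 'I_m -> nat) (T : tensor R N)
    (s : shape_partition N) (J : tidx N) (j k : 'I_m) :
  sp_symmetric T s -> sp_of s j = sp_of s k ->
  exists J' : tidx N, T J' = T J /\
    forall c, node s J' (tperm j k c) = node s J c.
Proof.
move=> sym ejk.
have of_f c : sp_of s (tperm j k c) = sp_of s c.
  by case: tpermP => // ->.
have N_f c : N (tperm j k c) = N c by rewrite !(sp_dims_of s) of_f.
pose J' : tidx N := [ffun c => cast_ord (N_f c) (J (tperm j k c))].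
have J'E c : J' c = J (tperm j k c) :> nat by rewrite ffunE.
exists J'; split=> [|c]; last first.
  by apply: bidx_eq; rewrite /= ?of_f // J'E tpermK.
apply: (sym (sp_of s j) j k); rewrite ?sp_ofP //.
- by rewrite ejk sp_ofP.
- by rewrite J'E tpermL.
- by rewrite J'E tpermR.
by move=> c cj ck; apply: val_inj; rewrite /= J'E tpermD // eq_sym.
Qed.

(** A node [a] at the smallest position of its block of [s] is moved to the
    smallest position of the surrounding block of [s'], where the definitions
    for [s'] look at it; the other nodes of [J] keep being at other positions
    because [f] is injective. *)
Lemma symmetric_coarsen (R : realType) (m : nat) (N : 'I_m -> nat)
    (T : tensor R N) (s s' : shape_partition N) (J : tidx N)
    (a : bidx (sp_dims s)) :
  sp_le s s' -> sp_symmetric T s' ->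
  exists (J' : tidx N) (f : {perm 'I_m}), [/\ T J' = T J,
    f (sp_min s (tag a)) = sp_min s' (tag (coarsen s' a)) &
    forall j, node s' J' (f j) = coarsen s' (node s J j)].
Proof.
move=> le sym; set k := sp_min s _; set k' := sp_min s' _.
have [|J' [TJ' J'E]] := @swap_entries _ _ _ _ _ J k k' sym.
  by rewrite sp_of_min.
exists J', (tperm k k'); split=> [//||j]; first exact: tpermL.
by rewrite coarsen_proj // J'E.
Qed.

Lemma strictly_nonnegative_le (R : realType) (m : nat) (N : 'I_m -> nat)
    (T : tensor R N) (s s' : shape_partition N) :
  (forall J, 0 <= T J) -> sp_le s s' ->
  strictly_nonnegative T s -> strictly_nonnegative T s'.
Proof.
(* The row [a] for [s'] is made of the same derivatives as the row
   [proj s (rep a)] for [s]. *)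
move=> T0 le sn a; have [b] := sn (proj s (rep a)).
move=> /(sp_jacobian_neq0P _ _ T0)[J [j [TJ Ja ja _]]].
rewrite /= sp_min_le // in Ja ja.
exists (node s' J j); apply/(sp_jacobian_neq0P _ _ T0); exists J, j; split=> //.
by rewrite -[LHS](@coarsen_proj _ _ s) // -/(node s _ _) Ja coarsenK.
Qed.

Lemma weakly_irreducible_le (R : realType) (m : nat) (N : 'I_m -> nat)
    (T : tensor R N) (s s' : shape_partition N) :
  (forall J, 0 <= T J) -> sp_le s s' -> sp_symmetric T s' ->
  weakly_irreducible T s -> weakly_irreducible T s'.
Proof.
move=> T0 le sym irr; split=> [/eqP/fintype1P[a eq_a]|Z /set0Pn[z Zz] ZT].
  have sn := strictly_nonnegative_le T0 le
    (weakly_irreducible_strictly_nonnegative irr).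
  by have [b] := sn a; rewrite (eq_a b) => ?; exists a.
have /subsetPn[z' _ Zz'] : ~~ ([set: _] \subset Z) by rewrite subTset.
have [|| a [b [Za Zb]]] := irr.2 (@coarsen _ _ s s' @^-1: Z).
- by apply/set0Pn; exists (proj s (rep z)); rewrite inE coarsenK.
- apply: contra Zz' => /eqP/setP/(_ (proj s (rep z'))).
  by rewrite !inE coarsenK // => ->.
rewrite !inE in Za Zb => /(sp_jacobian_neq0P _ _ T0)[J [j [TJ Ja ja Jb]]].
exists (coarsen s' a), (coarsen s' b); split=> //.
have [J' [f [TJ' fa J'E]]] := symmetric_coarsen J a le sym.
apply/(sp_jacobian_neq0P _ _ T0); exists J', (f j).
by rewrite -fa (inj_eq perm_inj) !J'E Ja Jb TJ'.
Qed.

Lemma strongly_irreducible_le (R : realType) (m : nat) (N : 'I_m -> nat)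
    (T : tensor R N) (s s' : shape_partition N) :
  (forall J, 0 <= T J) -> sp_le s s' -> sp_symmetric T s' ->
  strongly_irreducible T s -> strongly_irreducible T s'.
Proof.
move=> T0 le sym irr x' x'0 x'npos x'nz.
pose x : bvec R (sp_dims s) := fun i => \row_t coord x' (coarsen s' (mkbidx t)).
have xE a : coord x a = coord x' (coarsen s' a).
  by case: a => i t; rewrite /coord mxE.
have x0 a : 0 <= coord x a by rewrite xE.
have [|i|a [xa]] := irr x x0.
- by move=> xpos; apply: x'npos => a; rewrite -(coarsenK a le) -xE.
- have /rV0Pn[t x't] := x'nz (sp_of s' (sp_min s i)).
  pose u : 'I_(sp_dims s i) := cast_ord (esym (sp_dims_of s' (sp_min s i))) t.
  apply/rV0Pn; exists u; rewrite mxE.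
  by rewrite (_ : coarsen _ _ = mkbidx t) //; apply: bidx_eq.
case/(tgrad_expand_gt0P _ T0 x0) => J [TJ Ja xJ].
exists (coarsen s' a); rewrite -xE; split=> //.
have [J' [f [TJ' fa J'E]]] := symmetric_coarsen J a le sym.
apply/(tgrad_expand_gt0P _ T0 x'0); exists J'; split=> [||j].
- by rewrite TJ'.
- by rewrite -fa J'E Ja.
rewrite -fa -{1 2}(permKV f j) (inj_eq perm_inj) J'E -xE; exact: xJ.
Qed.

(* The two extra premises of the second item exclude the only counterexamples
   to it: order-one tensors (where M = 0) and the zero tensor of format
   1 x ... x 1 (where strong irreducibility is vacuous). *)
Theorem theorem3p1 (R : realType) (m : nat) (N : 'I_m -> nat)
    (hm : (0 < m)%N) (hN : forall j : 'I_m, (0 < N j)%N)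
    (T : tensor R N) (hT : forall J : tidx N, 0 <= T J)
    (s s' : shape_partition N) (hss' : sp_le s s') :
  (weakly_irreducible T s -> strictly_nonnegative T s) /\
  ((1 < m)%N -> (exists j : 'I_m, (1 < N j)%N) \/ (exists J : tidx N, T J != 0) ->
     strongly_irreducible T s -> weakly_irreducible T s) /\
  (strictly_nonnegative T s -> strictly_nonnegative T s') /\
  (weakly_irreducible T s -> sp_symmetric T s' -> weakly_irreducible T s') /\
  (strongly_irreducible T s -> sp_symmetric T s' -> strongly_irreducible T s').
Proof.
split; first exact: weakly_irreducible_strictly_nonnegative.
split=> [m1 nontriv irr|].
  apply: strongly_irreducible_weakly_irreducible => //.
  by case: nontriv => // /(strongly_irreducible_neq0 hN hT irr).
split; first exact: strictly_nonnegative_le.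
split=> irr sym; first exact: weakly_irreducible_le hss' sym irr.
exact: strongly_irreducible_le hss' sym irr.
Qed.
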